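(* For all integers $\ell\ge 3$, we have $$\frac{7\ell+2}{5}\ \le\ \tilde r(P_4,P_{\ell+1})\ \le\ \frac{7\ell+52}{5}.$$
   Context: $P_s$ denotes the path on $s$ vertices. Let $K_{\mathbb{N}}$ be the infinite complete graph on vertex set $\mathbb{N}$. In the $\tilde r(G,H)$-game, two players, Builder and Painter, play on the edge set of $K_{\mathbb{N}}$, with no edges coloured initially. In each round Builder chooses an edge and Painter colours it red or blue. Builder wins as soon as there is a red copy of $G$ or a blue copy of $H$. The on-line Ramsey number $\tilde r(G,H)$ is the minimum number of rounds within which Builder can guarantee to win, assuming both players play optimally (Builder minimising and Painter maximising the number of rounds). *)

(* Defs.v *)
From mathcomp Require Import all_boot.

Set Implicit Arguments.
Unset Strict Implicit.
Unset Printing Implicit Defensive.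

Record sgraph := SGraph {
  vertex : finType;
  adj : rel vertex;
  adj_sym : symmetric adj;
  adj_irrefl : irreflexive adj
}.

Section PathGraph.
Variable s : nat.

Definition path_adj : rel 'I_s :=
  fun i j => (i.+1 == j :> nat) || (j.+1 == i :> nat).

Lemma path_adj_sym : symmetric path_adj.
Proof. by move=> i j; rewrite /path_adj orbC. Qed.

Lemma path_adj_irrefl : irreflexive path_adj.
Proof. by move=> i; rewrite /path_adj orbb; apply/negbTE; rewrite gtn_eqF. Qed.

(* The path on [s] vertices (so with [s.-1] edges). *)
Definition path_graph : sgraph := SGraph path_adj_sym path_adj_irrefl.

End PathGraph.

Inductive color := Red | Blue.

Definition color_eqb (c d : color) : bool :=
  match c, d with Red, Red | Blue, Blue => true | _, _ => false end.

(* A position is the list of rounds played so far, latest first: the entry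
   [(u, v, c)] records that the edge {u, v} of the complete graph on [nat] was
   coloured [c]. *)
Definition position := seq (nat * nat * color).

Definition same_edge (u v x y : nat) : bool :=
  ((u == x) && (v == y)) || ((u == y) && (v == x)).

Definition edge_color (p : position) (c : color) (u v : nat) : bool :=
  has (fun e => same_edge u v e.1.1 e.1.2 && color_eqb c e.2) p.

Definition coloured (p : position) (u v : nat) : bool :=
  edge_color p Red u v || edge_color p Blue u v.

(* A copy is a subgraph, not necessarily induced. *)
Definition has_copy (G : sgraph) (p : position) (c : color) : Prop :=
  exists f : vertex G -> nat,
    injective f /\ forall x y, adj x y -> edge_color p c (f x) (f y).

Definition builder_won (G H : sgraph) (p : position) : Prop :=
  has_copy G p Red \/ has_copy H p Blue.

(* From position [p], Builder can force a win within [n] further rounds,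
   whatever Painter does. *)
Fixpoint builder_wins_within (G H : sgraph) (n : nat) (p : position) : Prop :=
  builder_won G H p \/
  match n with
  | 0 => False
  | m.+1 => exists u v : nat, [/\ u != v, ~~ coloured p u v &
      forall c : color, builder_wins_within G H m ((u, v, c) :: p)]
  end.

(* [r] is the on-line Ramsey number of [G] (red) and [H] (blue); the relation
   is functional in [r]. *)
Definition is_online_ramsey (G H : sgraph) (r : nat) : Prop :=
  builder_wins_within G H r [::] /\
  forall n : nat, builder_wins_within G H n [::] -> r <= n.

(* Main.v *)
Require Import Defs.
From mathcomp Require Import all_boot all_order all_algebra.
From Stdlib Require Classical_Prop.
From HB Require Import structures.
From mathcomp Require Import zify.

(** Why the theorem is true: both bounds come from the rate of two red edges for
every five blue edges of the path that is being built.

Lower bound.  Painter keeps every red component a star: an edge is painted red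
when one end has no red edge yet and the other end is not a leaf of a star with
at least two leaves ([paint], [painter_invariant]).  No red [P_4] ever appears
([no_red_P4]), so the game ends with a blue path on [l + 1] vertices.  A blue
edge either joins two vertices with red edges or has an end that is a leaf of a
star with at least two leaves.  So a path vertex without red edges has only such
leaves as neighbours on the path.  Let every red edge hand out at most 5 units
to its ends so that these leaves get at least 4, all other vertices with a red
edge at least 2, and vertices without red edges get nothing ([sum_weight]).  Along the path
the leaves pay for their neighbours, and the average is at least 2 per vertex; a
path falls short only if it alternates between the two kinds, and then a star
centre off the path makes up for it.  Hence there are at least [2 (l + 1) / 5] red
edges ([red_edges_of_blue_path]) besides the [l] blue ones.

Upper bound.  An edge whose red colouring would complete a red [P_4] is forced to
be blue.  Builder therefore wants red stars with two leaves: all further edges at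
the leaves are forced.  Builder maintains one blue path and distinguishes four
situations by what is known in red about its ends: nothing, one end has a red
edge, one end has two of them and one of the neighbours is still off the path,
or one end is a leaf of a red star and the other end has a red edge.  A
situation comes with a constant [v], and the claim is that Builder wins within
[n] rounds from a path with [e] edges as soon as [5 n + 7 e >= 7 l + v]: a round
costs 5, a new edge of the path earns 7, so a forced edge gains 2 and a red
answer loses 5.  Every situation leads to another one for which the inequality
still holds, however Painter answers ([wins_from_path_step] and its three
companions), which is an induction on [n] ([builder_strategy]). *)

Set Implicit Arguments.
Unset Strict Implicit.
Unset Printing Implicit Defensive.

Import Order.TTheory GRing.Theory Num.Theory.

(** * Positions and the game with repeated edges *)

Definition sub_position (p p' : position) : Prop :=
  forall c u v, edge_color p c u v -> edge_color p' c u v.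

Lemma color_eqbP c d : reflect (c = d) (color_eqb c d).
Proof. by case: c; case: d; constructor. Qed.

Lemma edge_color_cons p e c u v :
  edge_color (e :: p) c u v =
  (same_edge u v e.1.1 e.1.2 && color_eqb c e.2) || edge_color p c u v.
Proof. by []. Qed.

Lemma edge_later p e c u v : edge_color p c u v -> edge_color (e :: p) c u v.
Proof. by rewrite edge_color_cons => ->; rewrite orbT. Qed.

Lemma edge_here p c u v : edge_color ((u, v, c) :: p) c u v.
Proof. by rewrite edge_color_cons /same_edge !eqxx; case: c. Qed.

Lemma same_edge_sym u v x y : same_edge u v x y = same_edge v u x y.
Proof. by rewrite /same_edge orbC [X in X || _]andbC [X in _ || X]andbC. Qed.

Lemma edge_color_sym p c u v : edge_color p c u v = edge_color p c v u.
Proof. by apply: eq_has => e; rewrite same_edge_sym. Qed.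

Lemma sub_position_cons p e : sub_position p (e :: p).
Proof. by move=> c u v; exact: edge_later. Qed.

Lemma sub_position_trans q p r :
  sub_position p q -> sub_position q r -> sub_position p r.
Proof. by move=> pq qr c u v /pq /qr. Qed.

Lemma has_copy_sub G p p' c :
  sub_position p p' -> has_copy G p c -> has_copy G p' c.
Proof. by move=> pp' [f [fI fE]]; exists f; split=> // x y /fE /pp'. Qed.

Lemma builder_wins_within_leq G H n m p :
  n <= m -> builder_wins_within G H n p -> builder_wins_within G H m p.
Proof.
elim: n m p => [|n IHn] [|m] p //=; first by move=> _ []//; left.
move=> nm [won|[u [v [uv unc h]]]]; first by left.
by right; exists u, v; split=> // c; exact: IHn.
Qed.

(** The game in which Builder may also play an edge that is already coloured; Painter
may then even give it a second colour.  Such a round never helps Builder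
([force_wins]), and strategies become free of bookkeeping: only the distinctness
of vertices matters, not which edges are still uncoloured. *)
Fixpoint force (l n : nat) (p : position) : Prop :=
  builder_won (path_graph 4) (path_graph l.+1) p \/
  match n with
  | 0 => False
  | m.+1 => exists u v : nat, u != v /\ forall c : color, force l m ((u, v, c) :: p)
  end.

(** A round on an edge that already has colour [c] can be skipped: the branch where
Painter repeats [c] adds no coloured edge.  Comparing positions by inclusion
rather than equality makes the skipped entries harmless. *)
Lemma force_wins l n p p' :
  sub_position p p' -> force l n p ->
  builder_wins_within (path_graph 4) (path_graph l.+1) n p'.
Proof.
have won_sub q q' : sub_position q q' ->
    builder_won (path_graph 4) (path_graph l.+1) q ->
    builder_won (path_graph 4) (path_graph l.+1) q'.
  by move=> qq' [] h; [left|right]; apply: has_copy_sub h.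
elim: n p p' => [|n IHn] p p' pp' /=.
  by move=> [won|//]; left; exact: won_sub won.
move=> [won|[u [v [uv h]]]]; first by left; exact: won_sub won.
case unc: (coloured p' u v); last first.
  right; exists u, v; split; rewrite ?unc // => c.
  apply: IHn (h c) => d x y; rewrite !edge_color_cons => /orP[->//|/pp' ->].
  by rewrite orbT.
have [c col] : exists c, edge_color p' c u v.
  by case/orP: unc => ?; [exists Red|exists Blue].
apply: (@builder_wins_within_leq _ _ n n.+1); first by [].
apply: IHn (h c) => d x y; rewrite edge_color_cons /= => /orP[|/pp'//].
case/andP=> /orP[] /andP[/eqP-> /eqP->] /color_eqbP-> //.
by rewrite edge_color_sym.
Qed.

Lemma has_copy_path p c s k :
  uniq s -> sorted (edge_color p c) s -> k <= size s ->
  has_copy (path_graph k) p c.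
Proof.
move=> us ss ks; exists (fun i : 'I_k => nth 0 s i); split.
  move=> i j /eqP; rewrite nth_uniq ?(leq_trans (ltn_ord _)) //.
  by move/eqP/val_inj.
move=> i j /= /orP[/eqP ij|/eqP ij].
  rewrite -ij; apply: (sortedP 0 ss); rewrite ij.
  exact: leq_trans (ltn_ord _) ks.
rewrite edge_color_sym -ij; apply: (sortedP 0 ss); rewrite ij.
exact: leq_trans (ltn_ord _) ks.
Qed.

Lemma red_P4_wins l n p a b c d :
  uniq [:: a; b; c; d] -> edge_color p Red a b -> edge_color p Red b c ->
  edge_color p Red c d -> force l n p.
Proof.
move=> U ab bc cd; case: n => [|n]; left; left;
by apply: (has_copy_path (s := [:: a; b; c; d])) => //=; rewrite ab bc cd.
Qed.

Lemma play l n p u v :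
  u != v -> force l n ((u, v, Blue) :: p) -> force l n ((u, v, Red) :: p) ->
  force l n.+1 p.
Proof. by move=> uv fb fr; right; exists u, v; split=> // -[]. Qed.

(** The edge [u v] would be the middle edge of a red [P_4]. *)
Lemma forced_middle l n p a u v b :
  edge_color p Red a u -> edge_color p Red v b -> uniq [:: a; u; v; b] ->
  force l n ((u, v, Blue) :: p) -> force l n.+1 p.
Proof.
move=> au vb U fb; apply: (@play _ _ _ u v) => //.
  by move: U => /= /and4P[_]; rewrite inE negb_or => /andP[].
apply: (@red_P4_wins _ _ _ a u v b) => //;
by [exact: edge_later|exact: edge_here].
Qed.

(** The edge [u v] would be an end edge of a red [P_4]; so every edge from a leaf [v]
of a red star with centre [c] and another leaf [d] is forced. *)
Lemma forced_leaf l n p u v c d :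
  edge_color p Red v c -> edge_color p Red c d -> uniq [:: u; v; c; d] ->
  force l n ((u, v, Blue) :: p) -> force l n.+1 p.
Proof.
move=> vc cd U fb; apply: (@play _ _ _ u v) => //.
  by move: U => /= /andP[]; rewrite inE negb_or => /andP[].
apply: (@red_P4_wins _ _ _ u v c d) => //;
by [exact: edge_later|exact: edge_here].
Qed.

(** * Blue paths *)

(** Both ends of the path are named since Builder extends it at either end; [t] lists
the inner vertices from [x] to [w].  As the ends are distinct there is at least
one edge, and the number of edges is [(size t).+1]. *)
Definition blue_link (p : position) (x : nat) (t : seq nat) (w : nat) : bool :=
  uniq (x :: rcons t w) && path (edge_color p Blue) x (rcons t w).

Lemma blue_link_sub p p' x t w :
  sub_position p p' -> blue_link p x t w -> blue_link p' x t w.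
Proof.
move=> pp' /andP[U P]; rewrite /blue_link U /=.
by apply: sub_path P => u v; exact: pp'.
Qed.

Lemma blue_link_later p e x t w : blue_link p x t w -> blue_link (e :: p) x t w.
Proof. exact/blue_link_sub/sub_position_cons. Qed.

Lemma blue_link_sym p x t w : blue_link p x t w -> blue_link p w (rev t) x.
Proof.
move=> /andP[U P]; apply/andP; split.
  have ->: w :: rcons (rev t) x = rev (x :: rcons t w).
    by rewrite rev_cons rev_rcons.
  by rewrite rev_uniq.
have := rev_path (edge_color p Blue) x (rcons t w).
rewrite last_rcons belast_rcons rev_cons => ->.
by apply: sub_path P => u v; rewrite edge_color_sym.
Qed.

Lemma blue_link_cons p y x t w :
  edge_color p Blue y x -> y \notin x :: rcons t w -> blue_link p x t w ->
  blue_link p y (x :: t) w.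
Proof.
move=> yx yN /andP[U P]; rewrite /blue_link rcons_cons cons_uniq yN U /=.
by rewrite yx P.
Qed.

Lemma blue_link_rcons p x t w y :
  edge_color p Blue w y -> y \notin x :: rcons t w -> blue_link p x t w ->
  blue_link p x (rcons t w) y.
Proof.
move=> wy yN /andP[U P]; apply/andP; split.
  by rewrite -rcons_cons rcons_uniq yN.
by rewrite rcons_path P last_rcons.
Qed.

Lemma blue_link_uniq p x t w : blue_link p x t w -> uniq (x :: rcons t w).
Proof. by case/andP. Qed.

Lemma blue_link_wins l n p x t w :
  l <= (size t).+1 -> blue_link p x t w -> force l n p.
Proof.
move=> lt /andP[U P]; case: n => [|n]; left; right;
by apply: (has_copy_path U) => //=; rewrite size_rcons.
Qed.

Lemma fresh_vertices k (ws : seq nat) :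
  exists zs : seq nat,
    [/\ size zs = k, uniq zs & all (fun z => z \notin ws) zs].
Proof.
exists (iota (sumn ws).+1 k); rewrite size_iota iota_uniq; split=> //.
apply/allP => z; rewrite mem_iota => /andP[lt_z _]; apply/negP.
elim: ws lt_z => //= a s IHs lt_z; rewrite inE => /orP[/eqP eza|]; first lia.
by apply: IHs; lia.
Qed.

Lemma fresh_vertex (ws : seq nat) : exists z : nat, z \notin ws.
Proof.
by have [[|z zs] [//= _ _ /andP[zN _]]] := fresh_vertices 1 ws; exists z.
Qed.

(** * Builder's strategy *)

Lemma all_cons (T : Type) (a : pred T) x s : all a (x :: s) = a x && all a s.
Proof. by []. Qed.

Ltac split_vertices :=
  rewrite ?all_cons; cbv beta;
  rewrite ?(cons_uniq, rcons_uniq, mem_cat, mem_rcons, mem_rev, in_cons, in_nil);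
  rewrite ?negb_or.

(** Turns all distinctness hypotheses on vertices into atoms, so that [distinct] can
close each later distinctness goal by splitting it and looking the atoms up. *)
Ltac vertices_in_context :=
  repeat match goal with
  | H : is_true (uniq _) |- _ => move: H
  | H : is_true (all _ _) |- _ => move: H
  | H : is_true (_ \notin _) |- _ => move: H
  end;
  split_vertices;
  repeat match goal with
  | |- is_true (_ && _) -> _ => case/andP
  | |- _ -> _ => let H := fresh "dst" in move=> H
  end.

Ltac distinct :=
  lazymatch goal with
  | |- is_true (uniq _) => idtac
  | |- is_true (_ \notin _) => idtac
  | |- is_true (_ != _) => idtac
  | |- is_true (all _ _) => idtac
  end;
  split_vertices; repeat (apply/andP; split);
  solve [ assumption | done | rewrite eq_sym; assumption ].

Ltac edge_in_position :=
  solve [ repeat first [ assumption | exact: edge_here | apply: edge_later ] ].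
Ltac edges :=
  first [ edge_in_position | rewrite edge_color_sym; edge_in_position ].

(** Only the numbers of rounds and the lengths of paths enter the arithmetic, so the
facts about single vertices and edges are dropped first. *)
Ltac arith :=
  repeat match goal with
  | H : is_true (~~ _) |- _ => clear H
  | H : is_true (uniq _) |- _ => clear H
  | H : is_true (all _ _) |- _ => clear H
  | H : is_true (_ \in _) |- _ => clear H
  | H : is_true (blue_link _ _ _ _) |- _ => clear H
  | H : is_true (edge_color _ _ _ _) |- _ => clear H
  end; lia.
Ltac sizes := rewrite ?(size_rev, size_rcons) /=; arith.

(** Builder joins the end [x] to fresh vertices until Painter answers red.  Each blue
answer gains 2, so only the situation after the red answer has to be handled:
there the red round has been charged, and the path has grown to some [t'] that
still has the old inner vertices and still avoids the vertices [ws] set aside. *)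
Lemma extend_until_red l v (ws : seq nat) n p x (t : seq nat) w :
  (forall n' p' x' t' y, n' < n -> sub_position p p' ->
     blue_link p' x' t' w -> {subset t <= t'} -> edge_color p' Red x' y ->
     y \notin x' :: rcons t' w -> y \notin ws ->
     all (fun z => z \notin x' :: rcons t' w) ws ->
     7 * l + v <= 5 * n'.+1 + 7 * (size t').+1 -> force l n' p') ->
  blue_link p x t w -> all (fun z => z \notin x :: rcons t w) ws ->
  7 * l + v <= 5 * n + 7 * (size t).+1 -> force l n p.
Proof.
elim: n p x t => [|n IHn] p x t next link avoid budget.
  by apply: blue_link_wins link; arith.
have [short|?] := ltnP (size t).+1 l; last exact: blue_link_wins link.
have [y yN] := fresh_vertex (x :: rcons t w ++ ws).
move: yN; rewrite -cat_cons mem_cat negb_or => /andP[yN yws].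
have yx : y != x by apply: contraNneq yN => ->; rewrite inE eqxx.
apply: (@play _ _ _ y x) => //.
  apply: (IHn _ y (x :: t)); last sizes.
  - move=> n' p' x' t' z lt_n' pp' link' tt' xz zN zws avoid' budget'.
    apply: (next n' p' x' t' z) => //; first arith.
      by apply: sub_position_trans pp'; exact: sub_position_cons.
    by move=> c ct; apply: tt'; rewrite inE ct orbT.
  - by apply: blue_link_cons => //; [edges | exact: blue_link_later].
  - apply/allP => z zws; rewrite inE negb_or (allP avoid) // andbT.
    by apply: contraNneq yws => <-.
apply: (next n _ x t y) => //; try edges.
exact: blue_link_later.
Qed.

(** The constants 38, 36, 31 and 33 below matter only through their differences, which
are fixed by the exchanges between the four situations; the common shift leaves
enough rounds for every exchange to be completed while the path is too short. *)
Definition wins_from_path l n := forall p x t w,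
  blue_link p x t w -> 7 * l + 38 <= 5 * n + 7 * (size t).+1 -> force l n p.

Definition wins_from_red_end l n := forall p x t w x',
  blue_link p x t w -> edge_color p Red x x' -> x' != x -> x' != w ->
  7 * l + 36 <= 5 * n + 7 * (size t).+1 -> force l n p.

(** The end [x] is the centre of a red star with leaves [x'] and [y], and [y] is off
the path. *)
Definition wins_from_centre_end l n := forall p x t w x' y,
  blue_link p x t w -> edge_color p Red x x' -> edge_color p Red y x ->
  y \notin x :: rcons t w -> x' \notin [:: x; w; y] ->
  7 * l + 31 <= 5 * n + 7 * (size t).+1 -> force l n p.

(** The end [y] is a leaf of the red star with centre [c] and other leaf [d], so every
edge at [y] is forced; an edge from the other end [x] to an end of a new red edge
is forced too. *)
Definition wins_from_leaf_end l n := forall p x t y c d x',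
  blue_link p x t y -> edge_color p Red y c -> edge_color p Red c d ->
  uniq [:: y; c; d] -> edge_color p Red x' x -> x' != x ->
  7 * l + 33 <= 5 * n + 7 * (size t).+1 -> force l n p.

(** A blue answer to an edge from [x] to a fresh vertex extends the path; a red answer
makes [x] the centre of a star with the fresh vertex as spare leaf. *)
Lemma wins_from_red_end_step l n :
  (forall m, m < n -> wins_from_path l m) ->
  (forall m, m < n -> wins_from_centre_end l m) -> wins_from_red_end l n.
Proof.
move=> pathW centreW p x t w x' link xx' x'x x'w budget.
have [short|?] := ltnP (size t).+1 l; last exact: blue_link_wins link.
case: n => [|n] in pathW centreW budget *; first arith.
have [y yN] := fresh_vertex (x' :: x :: rcons t w).
have U := blue_link_uniq link; vertices_in_context.
apply: (@play _ _ _ y x); first distinct.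
  apply: (pathW n (leqnn _) _ y (x :: t) w); last sizes.
  by apply: blue_link_cons; [edges | distinct | exact: blue_link_later].
apply: (centreW n (leqnn _) _ x t w x' y); try edges; try distinct.
- exact: blue_link_later.
- sizes.
Qed.

(** The spare leaf [y] is appended at the other end [w]: the edge [w y] is forced. *)
Lemma wins_from_centre_end_step l n :
  (forall m, m < n -> wins_from_leaf_end l m) -> wins_from_centre_end l n.
Proof.
move=> leafW p x t w x' y link xx' yx yN x'N budget.
have [short|?] := ltnP (size t).+1 l; last exact: blue_link_wins link.
case: n => [|n] in leafW budget *; first arith.
have U := blue_link_uniq link; vertices_in_context.
apply: (@forced_leaf _ _ _ w y x x') => //; first distinct.
apply: (leafW n (leqnn _) _ x (rcons t w) y x x' y); try edges; try distinct.
- by apply: blue_link_rcons; [edges | distinct | exact: blue_link_later].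
- sizes.
Qed.

(** A vertex [g] off the path that has a red edge is worth two forced edges: once
Painter answers red on an edge [x' y] at the end of the path, both [x' g] and
[g y] are forced, and the path then ends at [y], which has a red edge. *)
Lemma wins_with_spare l n p x (t : seq nat) w g h :
  (forall m, m < n -> wins_from_red_end l m) ->
  blue_link p x t w -> edge_color p Red g h -> g \notin x :: rcons t w ->
  h \in t -> 7 * l + 37 <= 5 * n + 7 * (size t).+1 -> force l n p.
Proof.
move=> endW link gh gN ht budget.
apply: (@extend_until_red l 37 [:: g] n p x t w) => //; last first.
  by rewrite /= gN.
move=> {budget} m p' x' t' y lt_mn pp' link' tt' x'y yN yg gN' budget.
have {}ht := tt' h ht.
have {}gh := pp' _ _ _ gh.
have [short|?] := ltnP (size t').+1 l; last exact: blue_link_wins link'.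
case: m => [|[|m]] in lt_mn budget *; [arith|arith|].
have U' := blue_link_uniq link'.
have hx' : h != x'.
  by apply: contraTneq U' => <-; rewrite /= mem_rcons inE ht orbT.
have hy : h != y by apply: contraNneq yN => <-; rewrite inE mem_rcons inE ht !orbT.
have hg : h != g.
  move: gN'; rewrite /= andbT; apply: contraNneq => <-.
  by rewrite inE mem_rcons inE ht !orbT.
vertices_in_context.
apply: (@forced_middle _ _ _ y x' g h); try edges; first distinct.
apply: (@forced_middle _ _ _ x' y g h); try edges; first distinct.
apply: (endW m _ _ y (g :: x' :: t') w x'); try edges; try distinct.
- by arith.
- apply: blue_link_cons; [edges | distinct |].
  apply: blue_link_cons; [edges | distinct |].
  by do 2 apply: blue_link_later.
- sizes.
Qed.

Ltac link :=
  solve [ repeat first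
    [ assumption
    | apply: blue_link_cons; [edges | distinct | ]
    | apply: blue_link_later ] ].
Ltac link_rcons := apply: blue_link_rcons; [edges | distinct | ].

(** Builder plays a fresh edge [b a], and if it is red a second edge [e b].  A blue
edge is simply appended at the leaf [y], which is forced.  A red star with centre
[b] is absorbed completely except for its leaf [a]: [b] is appended at [x], and
the leaf [e] at [y] with one fresh vertex on each side of it.  If only the first
edge is red, [a] is appended at [x] and tested with one more fresh vertex [f];
this either extends the path or turns [a] into the centre of a star. *)
Lemma wins_from_leaf_end_step l n :
  (forall m, m < n -> wins_from_red_end l m) ->
  (forall m, m < n -> wins_from_centre_end l m) -> wins_from_leaf_end l n.
Proof.
move=> endW centreW p x t y c d x' link yc cd ycd x'x x'Nx budget.
have [short|?] := ltnP (size t).+1 l; last exact: blue_link_wins link.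
case: n => [|[|[|[|[|[|n]]]]]] in endW centreW budget *; try arith.
have U := blue_link_uniq link.
have [zs []] := fresh_vertices 5 (c :: d :: x' :: x :: rcons t y).
case: zs => [|a [|b [|e [|f [|g []]]]]] // _ Z N; vertices_in_context.
apply: (@play _ _ _ b a); first distinct.
  apply: (@forced_leaf _ _ _ b y c d); try edges; first distinct.
  apply: (endW n.+4 _ _ x (rcons (rcons t y) b) a x');
    try edges; try distinct; try sizes.
  by do 2 link_rcons; link.
apply: (@play _ _ _ e b); first distinct.
  apply: (@forced_middle _ _ _ x' x a b); try edges; first distinct.
  apply: (@play _ _ _ f a); first distinct.
    apply: (@forced_leaf _ _ _ e y c d); try edges; first distinct.
    apply: (endW n.+1 _ _ b (rev (rcons (rcons (a :: x :: t) y) e)) f a);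
      try edges; try distinct; try sizes.
    by apply: blue_link_sym; do 2 link_rcons; link.
  apply: (@forced_leaf _ _ _ g y c d); try edges; first distinct.
  apply: (@forced_leaf _ _ _ g b a f); try edges; first distinct.
  apply: (centreW n _ _ a (rcons (rcons (rcons (x :: t) y) g) b) e b f);
    try edges; try distinct; try sizes.
  by do 3 link_rcons; link.
apply: (@forced_middle _ _ _ x' x b a); try edges; first distinct.
apply: (@forced_leaf _ _ _ g y c d); try edges; first distinct.
apply: (@forced_leaf _ _ _ g e b a); try edges; first distinct.
apply: (@forced_leaf _ _ _ f e b a); try edges; first distinct.
apply: (centreW n _ _ b (rcons (rcons (rcons (x :: t) y) g) e) f e a);
  try edges; try distinct; try sizes.
by do 3 link_rcons; link.
Qed.

(** Builder again plays a fresh edge [b a] and, if it is red, a second edge [e b].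
The edges not yet forced are prepared so that a red answer creates a star whose
leaves force the rest: a blue edge [b a] is joined to the path only at an end
[x'] that already has a red edge, and a blue [e b] is joined at the end [b] of
the red edge [b a]. *)
Lemma wins_from_path_step l n :
  (forall m, m < n -> wins_from_red_end l m) ->
  (forall m, m < n -> wins_from_centre_end l m) ->
  (forall m, m < n -> wins_from_leaf_end l m) -> wins_from_path l n.
Proof.
move=> endW centreW leafW p x t w link budget.
have [short|?] := ltnP (size t).+1 l; last exact: blue_link_wins link.
have U := blue_link_uniq link.
have [zs []] := fresh_vertices 4 (x :: rcons t w).
case: zs => [|a [|b [|e [|f []]]]] // _ Z N; vertices_in_context.
case: n => [|n] in endW centreW leafW budget *; first arith.
apply: (@play _ _ _ b a); first distinct.
  (* The blue edge [b a] waits until the end [x'] has a red edge [x' y]: then a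
     blue [a x'] leaves the spare vertex [y], and a red one makes [x'] a centre. *)
  apply: (@extend_until_red l 33 [:: a; b] n _ x t w); last sizes.
  - move=> m p' x' t' y lt_mn pp' link' tt' x'y yN yab abN {}budget.
    have ba := pp' _ _ _ (edge_here p Blue b a).
    have [short'|?] := ltnP (size t').+1 l; last exact: blue_link_wins link'.
    have U' := blue_link_uniq link'; vertices_in_context.
    case: m => [|[|m]] in lt_mn budget *; try arith.
    apply: (@play _ _ _ a x'); first distinct.
      apply: (@wins_with_spare l m.+1 _ b (a :: x' :: t') w y x');
        try edges; try distinct; try sizes.
      + by move=> k lt_km; apply: endW; arith.
      + by link.
      + by rewrite !inE eqxx orbT.
    apply: (@forced_leaf _ _ _ w a x' y); try edges; first distinct.
    apply: (centreW m _ _ x' (rcons (rcons t' w) a) b a y);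
      try edges; try distinct; try sizes.
    by do 2 link_rcons; link.
  - exact: blue_link_later.
  - by distinct.
case: n => [|[|[|[|[|n]]]]] in endW centreW leafW budget *; try arith.
apply: (@play _ _ _ e b); first distinct.
  apply: (@play _ _ _ b x); first distinct.
    apply: (@wins_with_spare l n.+3 _ e (b :: x :: t) w a b);
      try edges; try distinct; try sizes.
    + by move=> k lt_km; apply: endW; arith.
    + by link.
    + by rewrite inE eqxx.
  apply: (@forced_leaf _ _ _ e x b a); try edges; first distinct.
  apply: (centreW n.+2 _ _ b (e :: x :: t) w x a);
    try edges; try distinct; try sizes.
  by link.
(* The star with centre [b] is red.  Its leaves [a] and [e] are absorbed at [x],
   and the centre is kept for the first red answer at the other end [w]. *)
apply: (@forced_leaf _ _ _ x a b e); try edges; first distinct.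
apply: (@forced_leaf _ _ _ f a b e); try edges; first distinct.
apply: (@forced_leaf _ _ _ f e b a); try edges; first distinct.
apply: (@extend_until_red l 34 [:: b] n.+1 _ w (rev (f :: a :: x :: t)) e).
- move=> m p' w' t' y lt_mn pp' link' tt' w'y yN yb bN {}budget.
  have eb : edge_color p' Red e b by apply: pp'; edges.
  have ba : edge_color p' Red b a by apply: pp'; edges.
  have at' : a \in t' by apply: tt'; rewrite mem_rev !inE eqxx orbT.
  have [short'|?] := ltnP (size t').+1 l; last exact: blue_link_wins link'.
  have U' := blue_link_uniq link'.
  have aw' : a != w'.
    by apply: contraTneq U' => <-; rewrite /= mem_rcons inE at' orbT.
  have ay : a != y.
    by apply: contraNneq yN => <-; rewrite inE mem_rcons inE at' !orbT.
  case: m => [|[|m]] in lt_mn budget *; try arith.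
  vertices_in_context.
  apply: (@forced_middle _ _ _ y w' b a); try edges; first distinct.
  apply: (@forced_middle _ _ _ w' y b a); try edges; first distinct.
  apply: (leafW m _ _ y (b :: w' :: t') e b a w');
    try edges; try distinct; try sizes.
  by link.
- by apply: blue_link_sym; link.
- by distinct.
- sizes.
Qed.

Lemma builder_strategy l n :
  [/\ wins_from_path l n, wins_from_red_end l n,
      wins_from_centre_end l n & wins_from_leaf_end l n].
Proof.
have [k] := ubnP n; elim: k n => // k IHk n; rewrite ltnS => le_nk.
have IH m (lt_mn : m < n) := IHk m (leq_trans lt_mn le_nk).
split; [apply: wins_from_path_step|apply: wins_from_red_end_step
       |apply: wins_from_centre_end_step|apply: wins_from_leaf_end_step];
by move=> m /IH[].
Qed.

(** Three rounds suffice to get the first blue edge; they cost 15 and earn 7, so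
[48 - 8 = 40 >= 38] remains.  The number 48 is what rounding down leaves of 52
when [n] is [(7 l + 52) %/ 5]. *)
Lemma builder_wins_short l n : 7 * l + 48 <= 5 * n -> 0 < l -> force l n [::].
Proof.
move=> budget l_gt0.
case: n => [|[|[|n]]] in budget *; try lia.
have start m p x y : n <= m -> x != y -> edge_color p Blue x y -> force l m p.
  move=> le_nm xy bxy; have [W _ _ _] := builder_strategy l m.
  apply: (W p x [::] y); last by rewrite /=; lia.
  by rewrite /blue_link /= inE xy bxy.
apply: (@play _ _ _ 1 0) => //; first by apply: (start _ _ 1 0) => //; lia.
apply: (@play _ _ _ 2 0) => //; first by apply: (start _ _ 2 0) => //; lia.
apply: (@forced_leaf _ _ _ 3 1 0 2) => //; try edges.
by apply: (start _ _ 3 1) => //; edges.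
Qed.

(** * Painter's strategy *)

HB.instance Definition _ := hasDecEq.Build color color_eqbP.

Definition red_degree (p : position) (v : nat) : nat :=
  count (fun e => (e.2 == Red) && ((e.1.1 == v) || (e.1.2 == v))) p.

(** While the red components are stars, this says that [v] is a leaf of a star with at
least two leaves. *)
Definition below_centre (p : position) (v : nat) : bool :=
  has (fun e => (e.2 == Red) &&
        ((e.1.1 == v) && (1 < red_degree p e.1.2) ||
         (e.1.2 == v) && (1 < red_degree p e.1.1))) p.

Lemma edge_colorP p c u v :
  reflect ((u, v, c) \in p \/ (v, u, c) \in p) (edge_color p c u v).
Proof.
apply: (iffP hasP) => [[[[a b] d] ep /andP[/= ab /color_eqbP cd]]|].
  by case/orP: ab cd ep => /andP[/eqP-> /eqP->] ->; [left|right].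
by case=> h; [exists (u, v, c)|exists (v, u, c)];
  rewrite //= /same_edge !eqxx ?orbT /=; apply/color_eqbP.
Qed.

Lemma below_centreP p v :
  reflect (exists2 c, edge_color p Red v c & 1 < red_degree p c)
          (below_centre p v).
Proof.
apply: (iffP hasP) => [[[[a b] d] ep /= /andP[/eqP dR]]|[c /edge_colorP vc dc]].
  rewrite {d}dR in ep *.
  case/orP=> /andP[/eqP<- deg]; [exists b|exists a] => //; apply/edge_colorP; auto.
by case: vc => h; [exists (v, c, Red)|exists (c, v, Red)];
  rewrite //= !eqxx dc ?orbT.
Qed.

Lemma red_degree_gt0 p u v : edge_color p Red u v -> 0 < red_degree p u.
Proof.
move=> /edge_colorP uv; rewrite -has_count; apply/hasP.
by case: uv => h; [exists (u, v, Red)|exists (v, u, Red)];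
  rewrite //= !eqxx ?orbT.
Qed.

Lemma leq_add_count (T : Type) (a b c : pred T) (s : seq T) :
  (forall x, ~~ (a x && b x)) -> (forall x, a x || b x -> c x) ->
  count a s + count b s <= count c s.
Proof.
move=> dis sub; rewrite -count_predUI [X in _ + X](_ : _ = 0) ?addn0.
  exact: sub_count.
by rewrite (@eq_count _ _ pred0) ?count_pred0 // => x; apply/negbTE/dis.
Qed.

Lemma red_degree_gt1 p u v w :
  edge_color p Red u v -> edge_color p Red u w -> v != w -> 1 < red_degree p u.
Proof.
move=> uv uw vw.
pose red_to x := fun e : nat * nat * color =>
  color_eqb Red e.2 && same_edge u x e.1.1 e.1.2.
apply: (@leq_trans (count (red_to v) p + count (red_to w) p)).
  apply: (@leq_add 1 1); rewrite -has_count.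
    by apply: sub_has uv => e; rewrite /red_to andbC.
  by apply: sub_has uw => e; rewrite /red_to andbC.
apply: leq_add_count => -[[a b] [|]]; rewrite /red_to /same_edge //=.
  apply/negP => /andP[/orP[]/andP[/eqP e1 /eqP e2] /orP[]/andP[/eqP e3 /eqP e4]];
  by subst; rewrite ?eqxx in vw.
by case/orP=> /orP[] /andP[/eqP-> _]; rewrite eqxx ?orbT.
Qed.

(** The second clause says that every red component is a star: no red edge has two ends
of red degree at least 2, which also excludes triangles.  The third one records
why Painter did not paint a blue edge red; it persists because red degrees grow. *)
Definition painter_invariant (p : position) : Prop :=
  [/\ forall c u v, edge_color p c u v -> u != v,
  (forall u v, edge_color p Red u v ->
     (red_degree p u <= 1) || (red_degree p v <= 1)) &
  (forall u v, edge_color p Blue u v ->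
     [|| (0 < red_degree p u) && (0 < red_degree p v),
         below_centre p u | below_centre p v])].

Definition paint (p : position) (u v : nat) : color :=
  if (red_degree p u == 0) && ~~ below_centre p v
     || (red_degree p v == 0) && ~~ below_centre p u
  then Red else Blue.

Lemma red_degree_cons p u v c w :
  red_degree ((u, v, c) :: p) w =
  ((c == Red) && ((u == w) || (v == w))) + red_degree p w.
Proof. by []. Qed.

Lemma leq_red_degree p e w : red_degree p w <= red_degree (e :: p) w.
Proof. by case: e => [[u v] c]; rewrite red_degree_cons leq_addl. Qed.

Lemma below_centre_later p e v : below_centre p v -> below_centre (e :: p) v.
Proof.
move=> /below_centreP[c vc dc]; apply/below_centreP; exists c.
  exact: edge_later.
exact: leq_trans dc (leq_red_degree _ _ _).
Qed.

(** The isolated vertex [u] is attached as a leaf to [v], which is a centre, an end of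
a single red edge or isolated too; so the new component is again a star.  The edge
[e] is given in either orientation because Painter's rule is symmetric. *)
Lemma star_forest_add p u v :
  (forall x y, edge_color p Red x y -> x != y) ->
  red_degree p u = 0 -> ~~ below_centre p v ->
  (forall x y, edge_color p Red x y ->
     (red_degree p x <= 1) || (red_degree p y <= 1)) ->
  forall e, e = (u, v, Red) \/ e = (v, u, Red) ->
  forall x y, edge_color (e :: p) Red x y ->
     (red_degree (e :: p) x <= 1) || (red_degree (e :: p) y <= 1).
Proof.
move=> loopless du bv star e ee.
have dE w : red_degree (e :: p) w = ((u == w) || (v == w)) + red_degree p w.
  by case: ee => ->; rewrite red_degree_cons //= orbC.
have old x y : edge_color p Red x y -> red_degree p x <= 1 ->
    (red_degree (e :: p) x <= 1) || (red_degree (e :: p) y <= 1).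
  move=> xy dx; rewrite !dE.
  have xu : u != x by apply: contraTneq (red_degree_gt0 xy) => <-; rewrite du.
  rewrite edge_color_sym in xy.
  have yu : u != y by apply: contraTneq (red_degree_gt0 xy) => <-; rewrite du.
  rewrite (negbTE xu) (negbTE yu) /=.
  have [vx|_] := eqVneq v x; last by rewrite add0n dx.
  rewrite edge_color_sym in xy.
  have dy : red_degree p y <= 1.
    rewrite leqNgt; apply: contra bv => dy; apply/below_centreP.
    by exists y; rewrite // vx.
  have [vy|_] := eqVneq v y; last by rewrite add0n dy orbT.
  by move: (loopless _ _ xy); rewrite -vx vy eqxx.
move=> x y; rewrite edge_color_cons => /orP[|xy].
  have -> : same_edge x y e.1.1 e.1.2 = same_edge x y u v.
    by case: ee => -> //=; rewrite /same_edge orbC.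
  rewrite !dE; case/andP=> /orP[]/andP[/eqP-> /eqP->] _.
    by rewrite eqxx du.
  by rewrite !eqxx du /= !orbT.
case/orP: (star x y xy) => d; first exact: old.
by rewrite orbC; apply: old; rewrite // edge_color_sym.
Qed.

Lemma painter_invariant_step p u v :
  u != v -> painter_invariant p ->
  painter_invariant ((u, v, paint p u v) :: p).
Proof.
move=> uv [loopless star blue].
have loopless' c d x y : edge_color ((u, v, c) :: p) d x y -> x != y.
  rewrite edge_color_cons => /orP[/andP[] | /loopless //].
  by case/orP=> /andP[/eqP-> /eqP->]; rewrite // eq_sym.
split; first exact: loopless'.
  have star_sub x y : edge_color p Red x y -> x != y by exact: loopless.
  rewrite /paint; case: ifP => [/orP[] /andP[/eqP deg below]|_] x y.
  - by apply: (star_forest_add star_sub deg below star); left.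
  - by apply: (star_forest_add star_sub deg below star); right.
  - rewrite edge_color_cons andbF => /star.
    by rewrite !red_degree_cons.
have later x y : [|| (0 < red_degree p x) && (0 < red_degree p y),
                     below_centre p x | below_centre p y] ->
    [|| (0 < red_degree ((u, v, paint p u v) :: p) x) &&
        (0 < red_degree ((u, v, paint p u v) :: p) y),
        below_centre ((u, v, paint p u v) :: p) x
      | below_centre ((u, v, paint p u v) :: p) y].
  case/or3P=> [/andP[dx dy]|bx|b_y]; apply/or3P.
  - apply: Or31; rewrite (leq_trans dx (leq_red_degree _ _ _)).
    exact: leq_trans dy (leq_red_degree _ _ _).
  - by apply: Or32; exact: below_centre_later.
  - by apply: Or33; exact: below_centre_later.
move=> x y; rewrite edge_color_cons => /orP[|xy]; last exact/later/blue.
case/andP=> xy_uv painted; apply: later.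
have {painted} : paint p u v = Blue by case: paint painted.
rewrite /paint; case: ifP => // /negbT.
rewrite !negb_or !negb_and !negbK -!lt0n => /andP[uP vP] _.
by case/orP: xy_uv => /andP[/eqP-> /eqP->];
  case/orP: uP => ->; rewrite ?orbT //; case/orP: vP => ->; rewrite ?orbT.
Qed.

Lemma no_red_P4 p :
  painter_invariant p -> ~ has_copy (path_graph 4) p Red.
Proof.
move=> [loopless star _] [f [fI fE]].
pose o (k : nat) (lt_k : k < 4) : 'I_4 := Ordinal lt_k.
pose a := @o 0 isT; pose b := @o 1 isT; pose c := @o 2 isT; pose d := @o 3 isT.
have ab : edge_color p Red (f b) (f a) by apply: fE.
have bc : edge_color p Red (f b) (f c) by apply: fE.
have cb : edge_color p Red (f c) (f b) by apply: fE.
have cd : edge_color p Red (f c) (f d) by apply: fE.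
have db : 1 < red_degree p (f b).
  by apply: (red_degree_gt1 ab bc); apply/negP => /eqP/fI.
have dc : 1 < red_degree p (f c).
  by apply: (red_degree_gt1 cb cd); apply/negP => /eqP/fI.
by case/orP: (star _ _ bc); rewrite leqNgt ?db ?dc.
Qed.

(** How the 5 units of the red edge [x y] are split, in the part going to [x]: in a star
with several leaves the leaf gets 4 and the centre 1, in a single edge each end
gets 2. *)
Definition share (p : position) (x y : nat) : nat :=
  if 1 < red_degree p y then 4 else if 1 < red_degree p x then 1 else 2.

Definition weight (p : position) (v : nat) : nat :=
  \sum_(e <- p | e.2 == Red)
     ((e.1.1 == v) * share p e.1.1 e.1.2 + (e.1.2 == v) * share p e.1.2 e.1.1).

Lemma share_bounds p x y : 0 < share p x y <= 4.
Proof. by rewrite /share; case: (1 < red_degree p y); case: (1 < red_degree p x). Qed.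

Lemma sum_weight p (s : seq nat) :
  painter_invariant p -> uniq s ->
  \sum_(v <- s) weight p v <= 5 * count (fun e => e.2 == Red) p.
Proof.
move=> [_ star _] us.
rewrite /weight exchange_big /= -sum1_count big_distrr /= big_seq_cond.
rewrite [in X in _ <= X]big_seq_cond; apply: leq_sum => -[[a b] c] /= /andP[ep /eqP cR].
rewrite {c}cR in ep.
have ab : edge_color p Red a b by apply/edge_colorP; left.
have one x (k : nat) : \sum_(v <- s) (x == v) * k <= k.
  rewrite -big_distrl /= -[X in _ <= X]mul1n leq_mul2r; apply/orP; right.
  have -> : \sum_(v <- s) (x == v) = count_mem x s.
    rewrite -sum1_count [RHS]big_mkcond; apply: eq_bigr => v _.
    by rewrite eq_sym /=; case: (v == x).
  by rewrite count_uniq_mem // leq_b1.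
rewrite big_split /= (leq_trans (leq_add (one _ _) (one _ _))) //.
rewrite /share; have := star a b ab.
by rewrite [_ <= 1]leqNgt [X in _ || X]leqNgt; do 2 case: (1 < _).
Qed.

Lemma weight_below_centre p v : below_centre p v -> 4 <= weight p v.
Proof.
case/hasP=> -[[a b] c] ep /= /andP[cR h].
rewrite /weight (big_rem _ ep) /= cR.
by case/orP: h => /andP[/eqP-> d]; rewrite /share eqxx d; lia.
Qed.

Lemma weight_red_degree p v : 0 < red_degree p v -> 2 <= weight p v.
Proof.
move=> deg; have [deg1|deg1] := leqP (red_degree p v) 1; last first.
  apply: leq_trans deg1 _; rewrite /red_degree -sum1_count /weight big_mkcond.
  rewrite [X in _ <= X]big_mkcond; apply: leq_sum => -[[a b] c] _ /=.
  case: (c == Red) => //=.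
  have := share_bounds p a b; have := share_bounds p b a.
  by case: (a == v); case: (b == v) => //=; lia.
have /hasP[[[a b] c] ep /= /andP[cR h]] : has (fun e => (e.2 == Red) &&
    ((e.1.1 == v) || (e.1.2 == v))) p by rewrite has_count.
rewrite /weight (big_rem _ ep) /= cR.
by case/orP: h => /eqP->;
  rewrite /share eqxx [1 < red_degree p v]ltnNge deg1 /=; case: ifP; lia.
Qed.

(** A vertex without red edges is preceded on the path by a leaf of a large star, whose
surplus of 2 pays for it, except when it starts the path; this explains the only
possible shortfall.  The second part strengthens this for
paths that meet a vertex of the third kind, with a red edge but no surplus.  This
vertex is not adjacent on the path to an unpaid vertex, so the balance is
nonnegative from there on; and a leaf at the start then keeps its surplus, which
is what makes the induction go through. *)
Lemma blue_path_weight p v s :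
  painter_invariant p -> path (edge_color p Blue) v s ->
  2 * size (v :: s) <= \sum_(x <- v :: s) weight p x + 2 * (red_degree p v == 0) /\
  (has (fun x => (0 < red_degree p x) && ~~ below_centre p x) (v :: s) ->
   2 * size (v :: s) + 2 * below_centre p v <= \sum_(x <- v :: s) weight p x).
Proof.
move=> [_ _ blue]; elim: s v => [|y s IHs] v.
  move=> _; rewrite big_cons big_nil /= orbF.
  have := @weight_red_degree p v; have := @weight_below_centre p v.
  case: (below_centre p v); case: (red_degree p v) => [|d] /=; lia.
rewrite [path _ _ _]/(_ && _) => /andP[vy /IHs[]] {IHs}.
have := blue v y vy.
rewrite [\sum_(x <- v :: _) _]big_cons.
have has_cons a : has a [:: v, y & s] = a v || has a (y :: s) by [].
rewrite {}has_cons.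
have -> : size [:: v, y & s] = (size (y :: s)).+1 by [].
set S := \sum_(x <- y :: s) _; set h := has _ (y :: s).
have := @weight_red_degree p v; have := @weight_below_centre p v.
have : below_centre p v -> 0 < red_degree p v.
  by case/below_centreP => c /red_degree_gt0.
have : below_centre p y -> 0 < red_degree p y.
  by case/below_centreP => c /red_degree_gt0.
case: (below_centre p v); case: (below_centre p y);
case: (red_degree p v) => [|dv]; case: (red_degree p y) => [|dy];
case: h => /=; lia.
Qed.

Lemma centre_not_below p v c :
  painter_invariant p -> edge_color p Red v c -> 1 < red_degree p c ->
  ~~ below_centre p c.
Proof.
move=> [_ star _] vc dc; apply/negP => /below_centreP[d cd dd].
by case/orP: (star c d cd); lia.
Qed.

(** If some path vertex has a red edge without being a leaf of a large star, the path
itself has enough weight.  Otherwise a path with at least two vertices contains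
such a leaf, and its centre, lying off the path, supplies the missing 2. *)
Lemma red_edges_of_blue_path p s :
  painter_invariant p -> uniq s -> sorted (edge_color p Blue) s ->
  1 < size s -> 2 * size s <= 5 * count (fun e => e.2 == Red) p.
Proof.
move=> inv; case: s => [|v [|y s]] // us bs _.
have bs' : path (edge_color p Blue) v (y :: s) by [].
have [weak strong] := blue_path_weight inv bs'.
set a := (fun x => _) in strong.
have [/strong le|noM] := boolP (has a [:: v, y & s]).
  by apply: (leq_trans _ (sum_weight inv us)); apply: (leq_trans _ le); rewrite leq_addr.
have [b bvs below] : exists2 b, b \in v :: y :: s & below_centre p b.
  have [bv|nbv] := boolP (below_centre p v); first by exists v; rewrite ?inE ?eqxx.
  have [b_y|nby] := boolP (below_centre p y).
    by exists y; rewrite ?inE ?eqxx ?orbT.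
  case/andP: bs => vy _; have [_ _ blue] := inv; move: (blue _ _ vy).
  rewrite (negbTE nbv) (negbTE nby) !orbF => /andP[dv _].
  by move: noM; rewrite /= /a dv nbv.
have /below_centreP[c bc dc] := below.
have ncb := centre_not_below inv bc dc.
have dc0 : 0 < red_degree p c by exact: ltnW.
have cN : c \notin v :: y :: s.
  by apply: contra noM => c_in; apply/hasP; exists c; rewrite // /a dc0.
have ucs : uniq (c :: v :: y :: s) by rewrite cons_uniq cN.
apply: (leq_trans _ (sum_weight inv ucs)); rewrite big_cons.
have := weight_red_degree dc0; move: weak.
set S := \sum_(_ <- _) _; case: (_ == 0) => /=; lia.
Qed.

Lemma blue_edges_of_blue_path p s :
  uniq s -> sorted (edge_color p Blue) s ->
  size s <= (count (fun e => e.2 == Blue) p).+1.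
Proof.
move=> us bs; apply: leq_trans
  (_ : (count (fun e => [&& e.2 == Blue, e.1.1 \in s & e.1.2 \in s]) p).+1 <= _);
  last by rewrite ltnS; apply: sub_count => e /and3P[].
elim: s us bs => // v [|y s] // IHs /= /andP[vN us] /andP[vy bs].
apply: leq_ltn_trans (IHs us bs) _; rewrite ltnS.
pose new := fun e : nat * nat * color =>
  color_eqb Blue e.2 && same_edge v y e.1.1 e.1.2.
have : 0 < count new p.
  by rewrite -has_count; apply: sub_has vy => e; rewrite /new andbC.
move=> new_gt0; apply: leq_trans (_ : count new p +
  count (fun e => [&& e.2 == Blue, e.1.1 \in y :: s & e.1.2 \in y :: s]) p <= _).
  by rewrite -[X in X < _]add0n ltn_add2r.
apply: leq_add_count => -[[a b] c].
  apply/negP => /andP[/andP[_ /=]] h /and3P[_ ay b_y].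
  by case/orP: h => /andP[/eqP e1 /eqP e2]; subst; rewrite ?ay ?b_y in vN.
case/orP => [/andP[/color_eqbP <-] | /and3P[-> ay b_y]] /=; last first.
  by rewrite [a \in v :: _]in_cons [b \in v :: _]in_cons ay b_y !orbT.
by case/orP=> /andP[/eqP<- /eqP<-]; rewrite !inE !eqxx ?orbT.
Qed.

(** Painter answers by [paint]; when the game ends, at least [2 (l + 1) / 5] red and [l]
blue rounds have been played. *)
Lemma painter_survives l n p :
  2 < l -> painter_invariant p ->
  builder_wins_within (path_graph 4) (path_graph l.+1) n p ->
  7 * l + 2 <= 5 * (n + size p).
Proof.
move=> l_gt2.
have won q : painter_invariant q ->
    builder_won (path_graph 4) (path_graph l.+1) q -> 7 * l + 2 <= 5 * size q.
  move=> inv [/(no_red_P4 inv) []|[f [fI fE]]].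
  pose s := mkseq (fun i => f (inord i : 'I_l.+1)) l.+1.
  have szs : size s = l.+1 by rewrite size_mkseq.
  have us : uniq s.
    rewrite map_inj_in_uniq ?iota_uniq // => i j; rewrite !mem_iota !add0n.
    by move=> /= lt_i lt_j /fI/(congr1 val); rewrite /= !inordK.
  have bs : sorted (edge_color q Blue) s.
    apply/(sortedP (f ord0)) => i; rewrite szs => lt_i.
    rewrite !nth_mkseq ?(ltnW lt_i) //; apply: fE.
    by rewrite /= /path_adj !inordK ?(ltnW lt_i) // eqxx.
  have := red_edges_of_blue_path inv us bs; have := blue_edges_of_blue_path us bs.
  have : count (fun e => e.2 == Red) q + count (fun e => e.2 == Blue) q = size q.
    rewrite -(count_predC (fun e => e.2 == Red)); congr (_ + _).
    by apply: eq_count => -[[a b] []].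
  by rewrite szs; lia.
elim: n p => [|n IHn] p inv /=; first by case=> // /(won _ inv).
case=> [/(won _ inv)|[u [v [uv _ h]]]]; first lia.
have := IHn _ (painter_invariant_step uv inv) (h (paint p u v)).
by rewrite [size _]/= addSnnS.
Qed.

(** * The on-line Ramsey number *)

Lemma exists_least (P : nat -> Prop) n :
  P n -> exists r, P r /\ forall m, P m -> r <= m.
Proof.
elim/ltn_ind: n => n IHn Pn.
have [[m [lt_mn Pm]]|none] := Classical_Prop.classic (exists m, m < n /\ P m).
  exact: IHn Pm.
exists n; split=> // m Pm; rewrite leqNgt; apply/negP => lt_mn.
by apply: none; exists m.
Qed.

Theorem theorem1p6 (l : nat) (hl : (3 <= l)%N) :
  exists r : nat,
    is_online_ramsey (path_graph 4) (path_graph l.+1) r /\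
    (((7 * l + 2)%N%:R / 5%:R <= r%:R :> rat)%R /\
     (r%:R <= (7 * l + 52)%N%:R / 5%:R :> rat)%R).
Proof.
have upper : builder_wins_within (path_graph 4) (path_graph l.+1)
               ((7 * l + 52) %/ 5) [::].
  apply: (@force_wins _ _ [::] [::]) => //; apply: builder_wins_short; lia.
have [r [r_wins r_min]] :=
  @exists_least (fun n => builder_wins_within _ _ n [::]) _ upper.
exists r; split; first by [].
rewrite ler_pdivrMr // ler_pdivlMr // -!natrM !ler_nat; split.
  have inv0 : painter_invariant [::] by split.
  have := painter_survives hl inv0 r_wins.
  by rewrite addn0; lia.
by have := r_min _ upper; rewrite mulnC; lia.
Qed.
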